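(* Let $k,\ell\in\mathbb{N}$ with $k\ge3$, let $n:=k\ell$, let $q\ge\frac14$ be real, and put $\widetilde q:=2q-\frac12$ and $\lambda:=2q-\frac12$. Consider $n$ unit charges at points $x_1<x_2<\cdots<x_n$ in $[-1,1]$ subject to the condition $$\cos\tfrac{(k-j)\pi}{k}<x_{j\ell+1}<x_{j\ell+2}<\cdots<x_{(j+1)\ell}<\cos\tfrac{(k-j-1)\pi}{k}\qquad (j=0,1,\dots,k-1),$$ in the presence of charges $q$ at the points $\pm1$ and charges $\widetilde q$ at the points $\cos\frac{j\pi}{k}$, $1\le j\le k-1$. Then the energy $$E(x_1,\dots,x_n):=-\sum_{i=1}^n\sum_{\substack{j=1\\ j\ne i}}^n\ln|x_i-x_j|-2q\sum_{i=1}^n\ln(1-x_i^2)-2\widetilde q\sum_{i=1}^n\ln\big|\widehat U_{k-1}(x_i)\big|$$ of this system is minimal when $x_1,\dots,x_n$ are the zeros of the sieved ultraspherical polynomial of the first kind $$c_n^\lambda(x;k)=\frac{\ell!}{(2\lambda)_\ell}\,C_\ell^\lambda\big(T_k(x)\big).$$ Moreover, the equilibrium position is unique.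
   Context: $(\alpha)_0:=1$ and $(\alpha)_n:=\alpha(\alpha+1)\cdots(\alpha+n-1)$ for $n\ge1$. Chebyshev polynomials: $T_n(\cos\theta)=\cos n\theta$, $U_n(\cos\theta)=\sin((n+1)\theta)/\sin\theta$; $\widehat U_n:=2^{-n}U_n$ is the monic version, so $\widehat U_{k-1}(x)=\prod_{j=1}^{k-1}(x-\cos\frac{j\pi}{k})$. Ultraspherical polynomials: for $\lambda\ne0$, $C_0^\lambda(x)=1$, $C_1^\lambda(x)=2\lambda x$ and $2(m+\lambda)xC_m^\lambda(x)=(m+1)C_{m+1}^\lambda(x)+(m+2\lambda-1)C_{m-1}^\lambda(x)$ for $m\ge1$. When $\lambda=0$ (i.e. $q=\frac14$) the expression $\frac{\ell!}{(2\lambda)_\ell}C_\ell^\lambda(T_k(x))$ is understood as its limit as $\lambda\to0$, namely $T_\ell(T_k(x))=T_n(x)$, which is $c_n^0(x;k)$. The polynomials $c_m^\lambda(x;k)$ satisfy $c_0^\lambda(x;k)=1$, $c_1^\lambda(x;k)=x$ and, for $m\ge1$: $2x\,c_m^\lambda=c_{m+1}^\lambda+c_{m-1}^\lambda$ if $k\nmid m$, and $2x(r+\lambda)c_m^\lambda=(r+2\lambda)c_{m+1}^\lambda+r\,c_{m-1}^\lambda$ if $m=rk$. Equilibrium positions are, by definition, the local minima of $E$ among the configurations satisfying the displayed ordering/interval condition. *)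

(* Defs.v *)
From mathcomp Require Export all_boot all_order all_algebra.
From mathcomp Require Export all_classical all_reals all_analysis.
From mathcomp Require Import ring lra.

Set Implicit Arguments.
Unset Strict Implicit.
Unset Printing Implicit Defensive.

Export Order.TTheory GRing.Theory Num.Theory.
Export numFieldNormedType.Exports.

Local Open Scope classical_set_scope.
Local Open Scope ring_scope.

Section Polynomials.
Variable R : realType.
Implicit Types (lam x t : R) (k m : nat).

Definition pochhammer (a : R) (n : nat) : R := \prod_(i < n) (a + i%:R).

(* Characterized by [chebT_cos] and [chebU_sin] below. *)
Fixpoint chebT (n : nat) : {poly R} :=
  match n with
  | 0 => 1
  | n'.+1 => match n' with
    | 0 => 'X
    | n''.+1 => 2 *: ('X * chebT n') - chebT n''
    end
  end.

Fixpoint chebU (n : nat) : {poly R} :=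
  match n with
  | 0 => 1
  | n'.+1 => match n' with
    | 0 => 2 *: 'X
    | n''.+1 => 2 *: ('X * chebU n') - chebU n''
    end
  end.

Lemma chebT_cos n t : (chebT n).[cos t] = cos (n%:R * t).
Proof.
elim/ltn_ind: n => -[|[|n]] IHn.
- by rewrite mul0r cos0 hornerC.
- by rewrite mul1r hornerX.
rewrite [chebT _]/= -/(chebT n.+1) hornerD hornerN hornerZ hornerM hornerX !IHn //.
have -> : n.+2%:R * t = n.+1%:R * t + t by rewrite -[n.+2%:R]natr1; ring.
have -> : n%:R * t = n.+1%:R * t - t by rewrite -[n.+1%:R]natr1; ring.
rewrite cosB cosD; ring.
Qed.

Lemma chebU_sin n t : (chebU n).[cos t] * sin t = sin (n.+1%:R * t).
Proof.
elim/ltn_ind: n => -[|[|n]] IHn.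
- by rewrite hornerC !mul1r.
- rewrite hornerZ hornerX.
  have -> : 2 * t = t + t by ring.
  by rewrite sinD; ring.
rewrite [chebU _]/= -/(chebU n.+1) hornerD hornerN hornerZ hornerM hornerX.
rewrite mulrBl -!mulrA IHn //  IHn //.
have -> : n.+3%:R * t = n.+2%:R * t + t by rewrite -[n.+3%:R]natr1; ring.
have -> : n.+1%:R * t = n.+2%:R * t - t by rewrite -[n.+2%:R]natr1; ring.
rewrite sinB sinD; ring.
Qed.

Definition monic_chebU (n : nat) : {poly R} := (2 ^+ n)^-1 *: chebU n.

Fixpoint ultraspherical lam (n : nat) : {poly R} :=
  match n with
  | 0 => 1
  | n'.+1 => match n' with
    | 0 => (2 * lam) *: 'X
    | n''.+1 => (n'.+1%:R)^-1 *:
        ((2 * (n'%:R + lam)) *: ('X * ultraspherical lam n')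
         - (n'%:R + 2 * lam - 1) *: ultraspherical lam n'')
    end
  end.

Lemma ultraspherical_rec lam m : (0 < m)%N ->
  (2 * (m%:R + lam)) *: ('X * ultraspherical lam m) =
  m.+1%:R *: ultraspherical lam m.+1
  + (m%:R + 2 * lam - 1) *: ultraspherical lam m.-1.
Proof.
case: m => // m _.
rewrite [ultraspherical lam m.+2]/= -/(ultraspherical lam m.+1).
by rewrite scalerA divff ?pnatr_eq0// scale1r subrK.
Qed.

(* l! / (2 lam)_l * C_l^lam; the quotient is 0/0 at lam = 0, where it stands for
   its limit, which is T_l by [normalized_ultraspherical_cvg0]. *)
Definition normalized_ultraspherical lam (l : nat) : {poly R} :=
  if lam == 0 then chebT l
  else (l`!%:R / pochhammer (2 * lam) l) *: ultraspherical lam l.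

Lemma normalized_ultraspherical_rec lam m x : lam != 0 -> - 2^-1 < lam ->
  (normalized_ultraspherical lam m.+2).[x] =
  (2 * (m.+1%:R + lam) * x * (normalized_ultraspherical lam m.+1).[x]
   - m.+1%:R * (normalized_ultraspherical lam m).[x]) / (m.+1%:R + 2 * lam).
Proof.
move=> lam0 lamN; rewrite /normalized_ultraspherical (negbTE lam0).
have p i : 2 * lam + i%:R != 0.
  case: i => [|i]; first by rewrite addr0 mulf_neq0.
  have : 0 <= i%:R :> R by [].
  rewrite -[i.+1%:R]natr1; move: i%:R => r r0.
  by rewrite gt_eqF//; lra.
have P i : pochhammer (2 * lam) i != 0 by apply/prodf_neq0 => j _; exact: p.
have := p m.+1; have := p m; have := P m.
rewrite [ultraspherical lam m.+2]/= -/(ultraspherical lam m.+1).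
rewrite /pochhammer 2![\prod_(i < _.+1) _]big_ord_recr/= !(hornerZ, hornerD, hornerN, hornerM, hornerX).
move: (ultraspherical lam m.+1).[x] (ultraspherical lam m).[x] => u v.
rewrite !factS !natrM.
have : m%:R + 1 != 0 :> R by rewrite natr1 pnatr_eq0.
have : m%:R + 1 + 1 != 0 :> R by rewrite !natr1 pnatr_eq0.
rewrite -![m.+2%:R]natr1 -![m.+1%:R]natr1.
move: (\prod_(i < m) _) => Q m2 m1 Q0 pm pm1.
field; rewrite Q0 pm m2 !andbT.
have -> : m%:R + 1 + 2 * lam = 2 * lam + (m%:R + 1) :> R by ring.
exact: pm1.
Qed.

Lemma normalized_ultraspherical_cvg0 l x :
  (normalized_ultraspherical mu l).[x] @[mu --> (0 : R)^'] --> (chebT l).[x].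
Proof.
elim/ltn_ind: l => -[|[|l]] IHl.
- apply: cvg_near_cst; near=> mu.
  rewrite /normalized_ultraspherical/=; case: ifP => // _.
  by rewrite /pochhammer big_ord0 divr1 scale1r.
- apply: cvg_near_cst; near=> mu.
  have mu0 : mu != 0 by near: mu; exact: nbhs_dnbhs_neq.
  rewrite /normalized_ultraspherical (negbTE mu0) /pochhammer big_ord1 addr0.
  by rewrite [chebT 1]/= [ultraspherical _ 1]/= !hornerZ hornerX factS fact0 muln1; field.
have muid : (mu : R) @[mu --> (0 : R)^'] --> (0 : R) by exact: cvg_within.
have H : ((2 * (l.+1%:R + mu) * x * (normalized_ultraspherical mu l.+1).[x]
   - l.+1%:R * (normalized_ultraspherical mu l).[x]) / (l.+1%:R + 2 * mu))
     @[mu --> (0 : R)^'] -->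
   (2 * (l.+1%:R + 0) * x * (chebT l.+1).[x] - l.+1%:R * (chebT l).[x])
     / (l.+1%:R + 2 * 0).
  apply: cvgM; last first.
    apply: cvgV; first by rewrite mulr0 addr0 pnatr_eq0.
    by apply: cvgD; [exact: cvg_cst|apply: cvgM => //; exact: cvg_cst].
  apply: cvgB; apply: cvgM; [|exact: IHl|exact: cvg_cst|exact: IHl].
  apply: cvgM; last exact: cvg_cst.
  apply: cvgM; first exact: cvg_cst.
  by apply: cvgD => //; exact: cvg_cst.
have -> : (chebT l.+2).[x] =
   (2 * (l.+1%:R + 0) * x * (chebT l.+1).[x] - l.+1%:R * (chebT l).[x])
     / (l.+1%:R + 2 * 0).
  rewrite [chebT l.+2]/= -/(chebT l.+1) !(hornerZ, hornerD, hornerN, hornerM, hornerX).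
  by field; rewrite addrC natr1 pnatr_eq0.
apply: cvg_trans H; apply: near_eq_cvg; near=> mu.
rewrite normalized_ultraspherical_rec//.
- by near: mu; exact: nbhs_dnbhs_neq.
- near: mu; apply: muid; apply: lt_nbhsr; lra.
Unshelve. all: by end_near.
Qed.

Fixpoint sieved_ultraspherical k lam (n : nat) : {poly R} :=
  match n with
  | 0 => 1
  | n'.+1 => match n' with
    | 0 => 'X
    | n''.+1 =>
        let cm := sieved_ultraspherical k lam n' in
        let cm1 := sieved_ultraspherical k lam n'' in
        if (k %| n')%N then
          let r := (n' %/ k)%N%:R in
          (r + 2 * lam)^-1 *: ((2 * (r + lam)) *: ('X * cm) - r *: cm1)
        else 2 *: ('X * cm) - cm1
    end
  end.

Lemma sieved_ultraspherical_rec_ndvd k lam m : ~~ (k %| m)%N ->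
  2 *: ('X * sieved_ultraspherical k lam m) =
  sieved_ultraspherical k lam m.+1 + sieved_ultraspherical k lam m.-1.
Proof.
case: m => [|m km]; first by rewrite dvdn0.
by rewrite [sieved_ultraspherical k lam m.+2]/= (negbTE km) subrK.
Qed.

Lemma sieved_ultraspherical_rec_dvd k lam r : 0 <= lam -> (0 < k)%N -> (0 < r)%N ->
  (2 * (r%:R + lam)) *: ('X * sieved_ultraspherical k lam (r * k)) =
  (r%:R + 2 * lam) *: sieved_ultraspherical k lam (r * k).+1
  + r%:R *: sieved_ultraspherical k lam (r * k).-1.
Proof.
move=> lam0 k0 r0; have := mulnK r k0; have := dvdn_mull r (dvdnn k).
case E : (r * k)%N => [|m] km rE.
  by move/eqP: E; rewrite muln_eq0 !gtn_eqF.
rewrite [sieved_ultraspherical k lam m.+2]/= km rE.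
rewrite scalerA divff ?scale1r ?subrK// gt_eqF// ltr_pwDl ?ltr0n//.
by rewrite mulr_ge0.
Qed.

End Polynomials.

Section Electrostatics.
Variables (R : realType) (n : nat).
Implicit Types (q qt : R) (x y : 'rV[R]_n).

(* With 0-based indices, the charges lying strictly between cos((k-j)pi/k) and
   cos((k-j-1)pi/k) are the [x 0 i] with j l <= i < (j+1) l. *)
Definition admissible (k l : nat) x : Prop :=
  [/\ forall i, -1 <= x 0 i <= 1,
      forall i i' : 'I_n, (i < i')%N -> x 0 i < x 0 i'
    & forall (j : 'I_k) (i : 'I_n), (j * l <= i < j.+1 * l)%N ->
        cos ((k - j)%:R * pi / k%:R) < x 0 i < cos ((k - j - 1)%:R * pi / k%:R)].

Definition energy (k : nat) q qt x : R :=
  - (\sum_(i < n) \sum_(j < n | j != i) ln `|x 0 i - x 0 j|)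
  - 2 * q * (\sum_(i < n) ln (1 - x 0 i ^+ 2))
  - 2 * qt * (\sum_(i < n) ln `|(monic_chebU R k.-1).[x 0 i]|).

Definition equilibrium (k l : nat) q qt x : Prop :=
  admissible k l x /\
  \forall y \near within (admissible k l) (nbhs x),
    energy k q qt x <= energy k q qt y.

End Electrostatics.

Arguments chebT {R} n.
Arguments chebU {R} n.
Arguments monic_chebU {R} n.

(* Main.v *)
Require Import Defs.
From mathcomp Require Import ring lra zify.

Set Implicit Arguments.
Unset Strict Implicit.
Unset Printing Implicit Defensive.

(** The energy is strictly convex: on the admissible configurations, which form a
    convex set, every logarithm in it is evaluated at a linear form of constant sign
    (for the charges at [+-1] because [1 - x^2 = (1 - x) (1 + x)], for the nodes
    because [U_{k-1}] splits into linear factors). So a critical point is the unique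
    minimum, and no other local minimum exists. Convexity enters as a tangent
    inequality: summing [ln |b| <= ln |a| + (b - a) / a] over all pairs of charges
    gives [energy_tangent_le], in which the [force] on each charge appears by itself,
    and [equilibrium_of_force0] draws the conclusions.

    It remains to find an admissible configuration without force. The identity
    [c_{rk}(x; k) = P_r (T_k x)] ([sieved_ultraspherical_comp]), with [P_r] the
    normalized ultraspherical polynomial, follows by eliminating all members of the
    sieved sequence whose index is not a multiple of [k]. Interlacing, propagated
    along the three-term recurrence of [P_r], provides [l] simple zeros of [P_l] in
    ]-1, 1[ ([interlacing_zeros_exist]), and [T_k] pulls them back to [l] zeros in
    each of its [k] monotonicity arcs ([admissible_sieved_zeros]); by degree these
    are all the zeros of [f = P_l o T_k].

    Finally, as Stieltjes observed, at a zero [x_i] of a polynomial [f] with simple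
    zeros the repulsion by the other zeros is [f''(x_i) / (2 f'(x_i))]. The
    ultraspherical differential equation at [T_k x_i], together with
    [(1 - x^2) T_k'^2 = k^2 (1 - T_k^2)], evaluates this quotient, and the result
    cancels the force of the fixed charges ([force_sieved_zeros]). *)

Local Open Scope classical_set_scope.
Local Open Scope ring_scope.

(** * Polynomials with prescribed roots *)

Section ProductsOfLinearFactors.
Variable R : realType.
Implicit Types p : {poly R}.

Lemma poly_eq_horner p1 p2 : (forall x, p1.[x] = p2.[x]) -> p1 = p2.
Proof.
move=> p12; apply/eqP; rewrite -subr_eq0; apply/negPn/negP => pN0.
suff : (size (mkseq (fun i => i%:R : R) (size (p1 - p2)%R)) < size (p1 - p2)%R)%N.
  by rewrite size_mkseq ltnn.
apply: max_poly_roots => //.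
- by apply/allP => x _; rewrite /root hornerD hornerN p12 subrr.
- by rewrite mkseq_uniq// => i j /eqP; rewrite eqr_nat => /eqP.
Qed.

Lemma poly_eq_prod_roots n (a : 'I_n -> R) p :
  (size p <= n.+1)%N -> injective a -> (forall i, root p (a i)) ->
  p = lead_coef p *: \prod_(i < n) ('X - (a i)%:P).
Proof.
move=> sp inja roota.
have [->|p0] := eqVneq p 0; first by rewrite lead_coef0 scale0r.
have ua : uniq [seq a i | i <- enum 'I_n] by rewrite map_inj_uniq ?enum_uniq.
have ra : all (root p) [seq a i | i <- enum 'I_n].
  by apply/allP => _ /mapP[i _ ->].
have sa : size [seq a i | i <- enum 'I_n] = n by rewrite size_map size_enum_ord.
rewrite {1}(@all_roots_prod_XsubC _ p [seq a i | i <- enum 'I_n])//.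
- by rewrite big_map big_enum.
- by apply/eqP; rewrite eqn_leq {1}sa sp; exact: max_poly_roots.
- by rewrite uniq_rootsE.
Qed.

Lemma horner_deriv_prod_XsubC (I : Type) (r : seq I) (P : pred I) (a : I -> R) y :
  (forall i, P i -> y != a i) ->
  (\prod_(i <- r | P i) ('X - (a i)%:P))^`().[y] =
  (\prod_(i <- r | P i) ('X - (a i)%:P)).[y] * \sum_(i <- r | P i) (y - a i)^-1.
Proof.
move=> ya; elim: r => [|i r IHr]; first by rewrite !big_nil derivC hornerC mulr0.
rewrite !big_cons; case: ifP => // Pi.
rewrite derivM derivXsubC mul1r hornerD !hornerM IHr hornerXsubC.
rewrite mulrDr mulrAC divff ?mul1r ?mulrA//.
by rewrite subr_eq0 ya.
Qed.

(** Writing [p = ('X - x_i) * g] gives [p'(x_i) = g(x_i)] and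
    [p''(x_i) = 2 g'(x_i)]: this turns the force that the other charges exert on
    [x_i] into a quotient of derivatives. *)
Lemma horner_deriv2_prod_XsubC n (a : 'I_n -> R) (c : R)
    (p := c *: \prod_(i < n) ('X - (a i)%:P)) i :
  c != 0 -> injective a ->
  p^`().[a i] != 0 /\
  p^`()^`().[a i] = 2 * p^`().[a i] * \sum_(j < n | j != i) (a i - a j)^-1.
Proof.
move=> c0 inja.
have aN j : j != i -> a i != a j by apply: contraNneq => /inja ->.
rewrite /p (bigD1 i)//=; have := horner_deriv_prod_XsubC (index_enum 'I_n) aN.
set g := \prod_(_ <- _ | _) _ => dg.
have gN0 : g.[a i] != 0.
  rewrite horner_prod; apply/prodf_neq0 => j ji.
  by rewrite hornerXsubC subr_eq0 aN.
rewrite !derivZ derivM derivXsubC mul1r derivD derivM derivXsubC mul1r.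
rewrite !(hornerXsubC, hornerZ, hornerM, hornerD) dg subrr !mul0r !addr0.
split; first by rewrite mulf_neq0.
by ring.
Qed.

End ProductsOfLinearFactors.

(** * Chebyshev polynomials *)

Section Chebyshev.
Variable R : realType.
Local Notation T := (@chebT R).

(** The shift [U_{n-1}], with [U_{-1} = 0], makes the identities below hold from
    [n = 0] on. *)
Definition chebUpred (n : nat) : {poly R} := if n is m.+1 then chebU m else 0.
Local Notation W := chebUpred.

Lemma chebTSS n : T n.+2 = 2 * 'X * T n.+1 - T n.
Proof. by rewrite [T n.+2]/= -/(T n.+1) scaler_nat -mulrA mulr_natl. Qed.

Lemma chebUpredSS n : W n.+2 = 2 * 'X * W n.+1 - W n.
Proof.
case: n => [|n]; first by rewrite /= scaler_nat mulr1 subr0 mulr_natl.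
by rewrite /= scaler_nat -mulrA mulr_natl.
Qed.

(** The addition formulas of [cos] and [sin] for [(n + 1) t = n t + t]. *)
Lemma chebTS_chebUpredS n :
  T n.+1 = 'X * T n - (1 - 'X^2) * W n /\ W n.+1 = 'X * W n + T n.
Proof.
elim: n => [|n [IHT IHW]]; first by rewrite /= !mulr0 mulr1 subr0 add0r.
by rewrite chebTSS chebUpredSS IHT IHW; split; ring.
Qed.

Lemma chebTS n : T n.+1 = 'X * T n - (1 - 'X^2) * W n.
Proof. exact: (chebTS_chebUpredS n).1. Qed.

Lemma chebUpredS n : W n.+1 = 'X * W n + T n.
Proof. exact: (chebTS_chebUpredS n).2. Qed.

(** [cos^2 + sin^2 = 1] at [n t]. *)
Lemma chebT_pell n : (T n) ^+ 2 + (1 - 'X^2) * (W n) ^+ 2 = 1.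
Proof.
elim: n => [|n IHn]; first by rewrite /= expr0n mulr0 addr0 expr1n.
by rewrite chebTS chebUpredS -[RHS]IHn; ring.
Qed.

Lemma chebT_chebUpred n : T n.+1 = 'X * W n.+1 - W n.
Proof. by rewrite chebTS chebUpredS; ring. Qed.

(** The determinant of two consecutive steps of the Chebyshev recurrence, which is
    what inverts a block of them in [sieved_ultraspherical_comp]. *)
Lemma chebUpred_turan n : (W n.+1) ^+ 2 - W n.+2 * W n = 1.
Proof.
by rewrite chebUpredSS -[RHS](chebT_pell n) chebUpredS; ring.
Qed.

(** What differentiating [cos (n t)] and [sin (n t)] along [x = cos t] gives. Each
    identity at [n + 1] needs both at [n], hence the joint induction. *)
Lemma deriv_chebT_chebUpred n :
  (T n)^`() = n%:R * W n /\ (1 - 'X^2) * (W n)^`() = 'X * W n - n%:R * T n.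
Proof.
elim: n => [|n [IHT IHW]]; first by rewrite /= derivC !mul0r deriv0 !mulr0 subr0.
rewrite chebTS chebUpredS !(derivD, derivN, derivM, derivXn, derivX, derivC) IHT.
rewrite /= expr1 -[n.+1%:R]natr1; split.
- have -> : (1 - 'X^2) * (W n)^`() = 'X * W n - n%:R * T n by [].
  by rewrite -mulr_natl; ring.
- transitivity ((1 - 'X^2) * (W n + n%:R * W n) + 'X * ((1 - 'X^2) * (W n)^`())).
    by ring.
  by rewrite IHW; ring.
Qed.

Lemma deriv_chebT n : (T n)^`() = n%:R * W n.
Proof. exact: (deriv_chebT_chebUpred n).1. Qed.

Lemma deriv_chebUpred n : (1 - 'X^2) * (W n)^`() = 'X * W n - n%:R * T n.
Proof. exact: (deriv_chebT_chebUpred n).2. Qed.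

Lemma chebT1 n : (T n).[1] = 1.
Proof. by rewrite -cos0 chebT_cos mulr0. Qed.

Lemma chebUpred1 n : (W n).[1] = n%:R.
Proof.
elim: n => [|n IHn]; first by rewrite horner0.
by rewrite chebUpredS hornerD hornerM hornerX IHn chebT1 mul1r natr1.
Qed.

Lemma size_chebT_chebUpred n : (size (T n) <= n.+1)%N /\ (size (W n) <= n)%N.
Proof.
elim/ltn_ind: n => -[|[|n]] IHn.
- by rewrite size_poly1 size_poly0.
- by rewrite size_polyX size_poly1.
have [[sT1 sW1] [sT sW]] := (IHn n.+1 (leqnn _), IHn n (leqnSn _)).
have sX (p : {poly R}) m : (size p <= m)%N -> (size (2 * 'X * p)%R <= m.+1)%N.
  move=> pm; rewrite -mulrA mulr_natl -scaler_nat.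
  rewrite (leq_trans (size_scale_leq _ _))//.
  have [->|p0] := eqVneq p 0; first by rewrite mulr0 size_poly0.
  by rewrite mulrC size_mulX.
split.
- rewrite chebTSS (leq_trans (size_polyD _ _))// size_polyN geq_max sX//=.
  by rewrite (leq_trans sT)// leqW// leqW.
- rewrite chebUpredSS (leq_trans (size_polyD _ _))// size_polyN geq_max sX//=.
  by rewrite (leq_trans sW)// leqW.
Qed.

Lemma size_chebT n : (size (T n) <= n.+1)%N.
Proof. exact: (size_chebT_chebUpred n).1. Qed.

Lemma sin_pi_frac_gt0 (k m : nat) : (0 < m < k)%N -> 0 < sin (m%:R * pi / k%:R : R).
Proof.
move=> /andP[m0 mk]; have k0 : 0 < k%:R :> R by rewrite ltr0n; lia.
have m0R : 0 < m%:R :> R by rewrite ltr0n.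
apply: sin_gt0_pi; rewrite divr_gt0 ?mulr_gt0 ?pi_gt0//=.
by rewrite ltr_pdivrMr// mulrC ltr_pM2l ?pi_gt0// ltr_nat.
Qed.

Lemma pi_frac_itv (k m : nat) : (0 < k)%N -> (m <= k)%N ->
  m%:R * pi / k%:R \in `[0, pi : R].
Proof.
move=> k_gt0 mk; have k0 : 0 < k%:R :> R by rewrite ltr0n.
rewrite in_itv/= divr_ge0 ?mulr_ge0 ?pi_ge0 ?ler0n//=.
by rewrite ler_pdivrMr// mulrC ler_pM2l ?pi_gt0// ler_nat.
Qed.

Lemma cos_pi_frac_lt (k m m' : nat) : (m' < m <= k)%N ->
  cos (m%:R * pi / k%:R : R) < cos (m'%:R * pi / k%:R).
Proof.
move=> /andP[m'm mk]; have k0 : (0 < k)%N by lia.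
rewrite ltr_cos ?pi_frac_itv//; last by lia.
have kR0 : 0 < k%:R :> R by rewrite ltr0n.
by rewrite ltr_pM2r ?invr_gt0// ltr_pM2r ?pi_gt0// ltr_nat.
Qed.

Lemma cos_pi_frac_le (k m m' : nat) : (m' <= m <= k)%N ->
  cos (m%:R * pi / k%:R : R) <= cos (m'%:R * pi / k%:R).
Proof.
rewrite leq_eqVlt => /andP[/orP[/eqP->//|m'm] mk].
by apply/ltW/cos_pi_frac_lt; rewrite m'm.
Qed.

(** The roots of [U_{k-1}], whose fixed charges fence off the blocks. *)
Definition sieve_node (k : nat) (m : 'I_k.-1) : R := cos (m.+1%:R * pi / k%:R).

Lemma sieve_node_inj k : injective (@sieve_node k).
Proof.
have lt_neq (m m' : 'I_k.-1) : (m' < m)%N -> sieve_node m < sieve_node m'.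
  by move=> m'm; apply: cos_pi_frac_lt; have := ltn_ord m; lia.
move=> m m' mm'; case: (ltngtP m m') => [/lt_neq|/lt_neq|/val_inj//] /lt_eqF.
- by rewrite mm' eqxx.
- by rewrite mm' eqxx.
Qed.

Lemma chebU_prod k : (0 < k)%N -> exists2 c : R, c != 0 &
  chebU k.-1 = c *: \prod_(m < k.-1) ('X - (sieve_node m)%:P).
Proof.
case: k => // k _ /=.
exists (lead_coef (chebU k)).
  rewrite lead_coef_eq0; apply/eqP => U0; have := chebUpred1 k.+1.
  by rewrite /= U0 horner0 => /esym/eqP; rewrite pnatr_eq0.
apply: poly_eq_prod_roots; last 2 first.
- exact: (@sieve_node_inj k.+1).
- move=> m; have mk : (0 < m.+1 < k.+1)%N by have /= := ltn_ord m; lia.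
  have k0 : k.+1%:R != 0 :> R by rewrite pnatr_eq0.
  have := chebU_sin k (m.+1%:R * pi / k.+1%:R : R).
  rewrite [X in _ = sin X]mulrC divfK//.
  rewrite [X in _ = sin X]mulr_natl -[X in _ = sin X]add0r.
  rewrite (alternatingn (@sinDpi R)) sin0 mulr0.
  by move/eqP; rewrite mulf_eq0 (gt_eqF (sin_pi_frac_gt0 mk)) orbF.
- exact: (size_chebT_chebUpred k.+1).2.
Qed.

End Chebyshev.
Arguments chebUpred {R} n.
(** * Normalized ultraspherical polynomials *)

Section NormalizedUltraspherical.
Variables (R : realType) (lam : R).
Hypothesis lam_ge0 : 0 <= lam.
Local Notation P := (normalized_ultraspherical lam).

Lemma normalized_ultraspherical0 : P 0 = 1.
Proof.
rewrite /normalized_ultraspherical/=; case: ifP => // _.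
by rewrite /pochhammer big_ord0 divr1 scale1r.
Qed.

Lemma normalized_ultraspherical1 : P 1 = 'X.
Proof.
rewrite /normalized_ultraspherical/=; case: eqVneq => //= lam0.
rewrite /pochhammer big_ord1 addr0 scalerA factS fact0 muln1 mul1r mulVf ?scale1r//.
by rewrite mulf_neq0.
Qed.

Lemma addn_2lam_gt0 m : 0 < m.+1%:R + 2 * lam.
Proof. by rewrite ltr_pwDl ?ltr0n// mulr_ge0. Qed.

(** The normalization makes the recurrence uniform in [lam]: at [lam = 0] it is
    the Chebyshev one multiplied by [m.+1]. *)
Lemma normalized_ultraspherical_rec_poly m :
  (m.+1%:R + 2 * lam)%:P * P m.+2 =
  (2 * (m.+1%:R + lam))%:P * 'X * P m.+1 - m.+1%:R%:P * P m.
Proof.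
have [lam0|lam0] := eqVneq lam 0.
  rewrite /normalized_ultraspherical lam0 eqxx chebTSS mulr0 !addr0.
  by rewrite polyCM; ring.
apply: poly_eq_horner => x.
rewrite !(hornerD, hornerN, hornerM, hornerC, hornerX).
have lamN : - 2^-1 < lam by rewrite (lt_le_trans _ lam_ge0)// oppr_lt0 invr_gt0.
rewrite normalized_ultraspherical_rec//.
by rewrite mulrC divfK// gt_eqF// addn_2lam_gt0.
Qed.

Lemma normalized_ultraspherical_horner_rec m x :
  (m.+1%:R + 2 * lam) * (P m.+2).[x] =
  2 * (m.+1%:R + lam) * x * (P m.+1).[x] - m.+1%:R * (P m).[x].
Proof.
have := congr1 (horner^~ x) (normalized_ultraspherical_rec_poly m).
by rewrite !(hornerD, hornerN, hornerM, hornerC, hornerX).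
Qed.

Lemma normalized_ultraspherical_at1 m : (P m).[1] = 1.
Proof.
elim/ltn_ind: m => -[|[|m]] IHm.
- by rewrite normalized_ultraspherical0 hornerC.
- by rewrite normalized_ultraspherical1 hornerX.
have := normalized_ultraspherical_horner_rec m 1; rewrite (IHm m.+1)// (IHm m)// => rec.
apply: (mulfI (lt0r_neq0 (addn_2lam_gt0 m))); rewrite rec; ring.
Qed.

Lemma normalized_ultrasphericalN m x : (P m).[- x] = (-1) ^+ m * (P m).[x].
Proof.
elim/ltn_ind: m => -[|[|m]] IHm.
- by rewrite normalized_ultraspherical0 !hornerC mulr1.
- by rewrite normalized_ultraspherical1 !hornerX expr1 mulN1r.
apply: (mulfI (lt0r_neq0 (addn_2lam_gt0 m))).
rewrite normalized_ultraspherical_horner_rec (IHm m.+1)// (IHm m)//.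
rewrite [RHS]mulrCA normalized_ultraspherical_horner_rec !exprS; ring.
Qed.

Lemma size_normalized_ultraspherical m : (size (P m) <= m.+1)%N.
Proof.
rewrite /normalized_ultraspherical; case: ifP => [_|_]; first exact: size_chebT.
rewrite (leq_trans (size_scale_leq _ _))//.
elim/ltn_ind: m => -[|[|m]] IHm; first by rewrite size_poly1.
  by rewrite (leq_trans (size_scale_leq _ _))// size_polyX.
rewrite [ultraspherical lam m.+2]/= -/(ultraspherical lam m.+1).
rewrite (leq_trans (size_scale_leq _ _))// (leq_trans (size_polyD _ _))//.
rewrite geq_max size_polyN !(leq_trans (size_scale_leq _ _))//.
- by rewrite (leq_trans (IHm _ _))// leqW.
- have [->|u0] := eqVneq (ultraspherical lam m.+1) 0.
    by rewrite mulr0 size_poly0.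
  by rewrite mulrC size_mulX// ltnS IHm.
Qed.

(** The differential-difference relation. With the recurrence it expresses
    [P (m + 1)'] and [P m'] through [P (m + 1)] and [P m] alone, and thereby
    encodes the ultraspherical differential equation. *)
Lemma deriv_normalized_ultraspherical m :
  (1 - 'X^2) * (P m.+1)^`() = m.+1%:R%:P * (P m - 'X * P m.+1).
Proof.
elim/ltn_ind: m => -[|m] IHm.
  by rewrite normalized_ultraspherical0 normalized_ultraspherical1 derivX; ring.
have c0 : (m.+1%:R + 2 * lam)%:P != 0 :> {poly R}.
  by rewrite polyC_eq0 gt_eqF// addn_2lam_gt0.
apply: (mulfI c0); have := congr1 (@deriv R) (normalized_ultraspherical_rec_poly m).
rewrite !(derivB, derivM, derivX, derivC) !mul0r !add0r mulr1 => drec.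
rewrite [LHS]mulrCA drec.
(* The relation for [(P m)'], with [P m.-1] traded for [P m.+1]. *)
have IH0 : (1 - 'X^2) * (P m)^`() =
    (m%:R + 2 * lam)%:P * ('X * P m - P m.+1).
  case: m IHm {c0 drec} => [|m] IHm.
    by rewrite normalized_ultraspherical0 normalized_ultraspherical1 derivC; ring.
  rewrite IHm// [RHS]mulrBr normalized_ultraspherical_rec_poly.
  by rewrite !(polyCD, polyCM); ring.
transitivity ((2 * (m.+1%:R + lam))%:P * ((1 - 'X^2) * P m.+1
    + 'X * ((1 - 'X^2) * (P m.+1)^`())) - m.+1%:R%:P * ((1 - 'X^2) * (P m)^`())).
  by ring.
rewrite IH0 IHm//.
transitivity (m.+2%:R%:P * ((m.+1%:R + 2 * lam)%:P * P m.+1 -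
    'X * ((m.+1%:R + 2 * lam)%:P * P m.+2))); last by ring.
rewrite normalized_ultraspherical_rec_poly -[m.+2%:R]natr1 -[m.+1%:R]natr1.
by rewrite !(polyCD, polyCM); ring.
Qed.

(** The differential equation
    [(1 - t^2) P'' - (2 lam + 1) t P' + l (l + 2 lam) P = 0] at a zero of [P]. *)
Lemma ultraspherical_ode_root l t : 1 - t ^+ 2 != 0 -> root (P l) t ->
  (1 - t ^+ 2) * (P l)^`()^`().[t] = (2 * lam + 1) * t * (P l)^`().[t].
Proof.
case: l => [|l] t1; first by rewrite normalized_ultraspherical0 rootC oner_eq0.
move=> /eqP Pt; apply: (mulfI t1).
have := congr1 (horner^~ t) (deriv_normalized_ultraspherical l).
have := congr1 (horner^~ t) (congr1 (@deriv R) (deriv_normalized_ultraspherical l)).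
rewrite !(derivB, derivM, derivX, derivC, derivXn) /= expr1.
rewrite !(hornerD, hornerN, hornerM, hornerC, hornerX, hornerXn, hornerMn) Pt.
have dl : (1 - t ^+ 2) * (P l)^`().[t] = (l%:R + 2 * lam) * t * (P l).[t].
  case: l Pt {t1} => [|l] Pt.
    move: Pt; rewrite normalized_ultraspherical0 normalized_ultraspherical1.
    by rewrite hornerX => ->; rewrite derivC horner0; ring.
  have := congr1 (horner^~ t) (deriv_normalized_ultraspherical l).
  rewrite !(hornerD, hornerN, hornerM, hornerC, hornerX, hornerXn) => ->.
  have := normalized_ultraspherical_horner_rec l t.
  by rewrite Pt -[l.+1%:R]natr1 => rec; lra.
rewrite -[l.+1%:R]natr1; move: dl.
move: (P l).[t] (P l)^`().[t] (P l.+1)^`().[t] (P l.+1)^`()^`().[t].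
move=> u u' v' v'' dl dv'' dv'.
have -> : (1 - t ^+ 2) * v'' = 2 * t * v' + (l%:R + 1) * (u' - t * v') by lra.
have E : (1 - t ^+ 2) * v' = (l%:R + 1) * u by lra.
transitivity ((1 - l%:R) * t * ((1 - t ^+ 2) * v') +
  (l%:R + 1) * ((1 - t ^+ 2) * u')); first by ring.
rewrite dl.
transitivity ((1 - l%:R) * t * ((1 - t ^+ 2) * v') +
  (l%:R + 2 * lam) * t * ((l%:R + 1) * u)); first by ring.
by rewrite -E; ring.
Qed.

End NormalizedUltraspherical.
(** * The sieved polynomials as compositions *)

Section SievedComposition.
Variables (R : realType) (lam : R) (k : nat).
Local Notation P := (normalized_ultraspherical lam).
Local Notation c := (sieved_ultraspherical k lam).
Local Notation T := (@chebT R).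
Local Notation W := (@chebUpred R).

(** Between two consecutive multiples of [k] the sieved recurrence is the one
    of the Chebyshev polynomials. *)
Lemma sieved_block r j : (j < k)%N ->
  c (r * k + j.+1) = W j.+1 * c (r * k).+1 - W j * c (r * k).
Proof.
elim/ltn_ind: j => -[|[|j]] IHj jk.
- by rewrite [W 1]/= [W 0]/= mul1r mul0r subr0 addn1.
- have := @sieved_ultraspherical_rec_ndvd _ k lam (r * k + 1).
  rewrite dvdn_addr ?dvdn_mull// dvdn1 gtn_eqF// => /(_ isT).
  rewrite addn1 addn2 -pred_Sn [W 2]/= [W 1]/= mul1r -scalerAl => ->.
  by rewrite addrK.
- have := @sieved_ultraspherical_rec_ndvd _ k lam (r * k + j.+2).
  rewrite dvdn_addr ?dvdn_mull// gtnNdvd// => /(_ isT).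
  rewrite addnS -pred_Sn -addnS => rec.
  rewrite [in LHS]addnS -[LHS](addrK (c (r * k + j.+1))) -rec.
  rewrite (IHj j)//; last by lia.
  rewrite (IHj j.+1)//; last by lia.
  by rewrite scaler_nat (chebUpredSS R j.+1) (chebUpredSS R j); ring.
Qed.

(** Let [a], [p], [b] be the members of index [r k], [r k - 1], [r k + 1]. The
    block read forwards from [r k] gives [W_k b - W_{k-1} a] for the next multiple
    of [k], the one read backwards gives [W_k p - W_{k-1} a] for the previous one,
    and the sieved relation at [r k] eliminates [b] and [p]; what remains is the
    recurrence of [P] at [T_k], since [T_k = x W_k - W_{k-1}]. *)
Lemma sieved_ultraspherical_comp r : 0 <= lam -> (2 <= k)%N ->
  c (r * k) = P r \Po T k.
Proof.
move=> lam_ge0; case: k sieved_block => [|[|m]]// block _.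
have Tm : T m.+2 = 'X * W m.+2 - W m.+1 by rewrite chebT_chebUpred.
elim/ltn_ind: r => -[|[|r]] IHr.
- by rewrite mul0n normalized_ultraspherical0 comp_polyC.
- rewrite normalized_ultraspherical1 comp_polyX Tm.
  have := block 0%N m.+1 (leqnn _); rewrite mul0n add0n mul1n => ->.
  by rewrite [sieved_ultraspherical _ _ 1]/= [sieved_ultraspherical _ _ 0]/=; ring.
have b0 := block r m.+1 (leqnn _); have b1 := block r m (leqnSn _).
have bp := block r.+1 m.+1 (leqnn _).
have E i : (i * m.+2 + m.+2)%N = (i.+1 * m.+2)%N by rewrite mulSn addnC.
rewrite E in b0; rewrite E in bp.
have := @sieved_ultraspherical_rec_dvd _ m.+2 lam r.+1 lam_ge0 isT isT.
have -> : (r.+1 * m.+2).-1 = (r * m.+2 + m.+1)%N by lia.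
rewrite -!mul_polyC => rec.
have c0 : (r.+1%:R + 2 * lam)%:P != 0 :> {poly R}.
  by rewrite polyC_eq0 gt_eqF// addn_2lam_gt0.
apply: (mulfI c0); rewrite bp.
(* The backward reading, obtained by inverting the forward one. *)
have back : W m.+2 * sieved_ultraspherical m.+2 lam (r * m.+2 + m.+1) =
    W m.+1 * sieved_ultraspherical m.+2 lam (r.+1 * m.+2) +
    sieved_ultraspherical m.+2 lam (r * m.+2).
  by rewrite b0 b1 -[X in _ = _ + X]mul1r -(chebUpred_turan R m); ring.
have IH1 := IHr r.+1 (leqnn _); have IH0 := IHr r (leqnSn _).
have := congr1 (comp_poly (T m.+2)) (normalized_ultraspherical_rec_poly lam_ge0 r).
rewrite !(comp_polyB, comp_polyM, comp_polyC, comp_polyX) => ->.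
rewrite -IH1 -IH0 Tm.
transitivity (W m.+2 * ((r.+1%:R + 2 * lam)%:P *
    sieved_ultraspherical m.+2 lam (r.+1 * m.+2).+1) -
  (r.+1%:R + 2 * lam)%:P * W m.+1 * sieved_ultraspherical m.+2 lam (r.+1 * m.+2)).
  by ring.
transitivity (W m.+2 * ((2 * (r.+1%:R + lam))%:P *
    ('X * sieved_ultraspherical m.+2 lam (r.+1 * m.+2))) -
  r.+1%:R%:P * (W m.+2 * sieved_ultraspherical m.+2 lam (r * m.+2 + m.+1)) -
  (r.+1%:R + 2 * lam)%:P * W m.+1 * sieved_ultraspherical m.+2 lam (r.+1 * m.+2)).
  by rewrite rec; ring.
by rewrite back !(polyCD, polyCM); ring.
Qed.

End SievedComposition.

(** * Interlacing of the zeros *)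

Section Interlacing.
Variables (R : realType) (lam : R).
Local Notation P := (normalized_ultraspherical lam).

Definition increasing_upto (n : nat) (t : nat -> R) :=
  forall i j, (i < j <= n)%N -> t i < t j.

Lemma increasing_uptoP n t : (forall i, (i < n)%N -> t i < t i.+1) ->
  increasing_upto n t.
Proof.
move=> tS i j /andP[ij jn]; elim: j ij jn => // j IHj.
rewrite ltnS leq_eqVlt => /orP[/eqP->|ij] jn; first exact: tS.
by rewrite (lt_trans (IHj ij (ltnW jn)))// tS.
Qed.

(** Between [t_i] and [t_(i + 1)] exactly [l - i] factors are negative. *)
Lemma sign_prod_XsubC l (t : nat -> R) i z :
  increasing_upto l.+1 t -> (i <= l)%N -> t i < z < t i.+1 ->
  0 < (-1) ^+ (l - i) * (\prod_(j < l) ('X - (t j.+1)%:P)).[z].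
Proof.
move=> tI il /andP[tz zt]; rewrite horner_prod.
have -> : (-1) ^+ (l - i) = \prod_(j < l) (if (j < i)%N then 1 else -1) :> R.
  elim: l il {tI} => [|l IHl] il; first by rewrite big_ord0.
  rewrite big_ord_recr/=; move: il; rewrite leq_eqVlt => /orP[/eqP->|il].
    rewrite subnn ltnSn mulr1 big1// => j _.
    by rewrite (ltn_trans (ltn_ord j)).
  by rewrite subSn// exprSr IHl// ltnNge -ltnS il.
rewrite -big_split/=; apply: prodr_gt0 => j _; rewrite hornerXsubC.
have tI' a b : (a <= b <= l.+1)%N -> t a <= t b.
  by rewrite leq_eqVlt => /andP[/orP[/eqP->|ab] bl]//; rewrite ltW// tI// ab.
have jl := ltn_ord j; case: ifPn => ji.
- by rewrite mul1r subr_gt0 (le_lt_trans _ tz)// tI'; lia.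
- by rewrite mulN1r oppr_gt0 subr_lt0 (lt_le_trans zt)// tI'; lia.
Qed.

(** The interior points [t_1 < ... < t_l] are the zeros of [P l]; the alternating
    signs of [P l.-1] there say that the zeros of the two polynomials interlace. *)
Definition interlacing_zeros (l : nat) (t : nat -> R) :=
  [/\ t 0%N = -1, t l.+1 = 1, increasing_upto l.+1 t,
      forall i, (0 < i <= l)%N -> root (P l) (t i)
    & forall i, (0 < i <= l)%N -> 0 < (-1) ^+ (l - i) * (P l.-1).[t i]].

Lemma interlacing_zeros_itv l t a : interlacing_zeros l t -> (a < l)%N ->
  -1 < t a.+1 < 1.
Proof.
move=> [t0 tl tI _ _] al.
by apply/andP; split; [rewrite -t0|rewrite -tl]; apply: tI; lia.
Qed.

Hypothesis lam_ge0 : 0 <= lam.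

Lemma normalized_ultraspherical_prod l t : interlacing_zeros l t ->
  exists2 a, 0 < a & P l = a *: \prod_(j < l) ('X - (t j.+1)%:P).
Proof.
move=> [_ tl tI rt _].
have PE : P l = lead_coef (P l) *: \prod_(j < l) ('X - (t j.+1)%:P).
  apply: poly_eq_prod_roots => [|i j tij|i].
  - exact: size_normalized_ultraspherical.
  - have il := ltn_ord i; have jl := ltn_ord j.
    case: (ltngtP i j) => [ij|ji|/val_inj//].
    + have /lt_eqF : t i.+1 < t j.+1 by apply: tI; lia.
      by rewrite tij eqxx.
    + have /lt_eqF : t j.+1 < t i.+1 by apply: tI; lia.
      by rewrite tij eqxx.
  - by apply: rt; rewrite /= ltn_ord.
exists (lead_coef (P l)) => //.
have : 0 < (P l).[1] by rewrite normalized_ultraspherical_at1.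
rewrite {1}PE hornerZ horner_prod pmulr_lgt0//; apply: prodr_gt0 => j _.
by rewrite hornerXsubC subr_gt0 -tl tI//= !ltnS ltn_ord leqnn.
Qed.

(** At the zeros of [P l] the recurrence makes [P l.+1] opposite to [P l.-1], and
    [P l.+1] has the next sign at both ends [-1] and [1] as well. *)
Lemma sign_next l t i : (0 < l)%N -> interlacing_zeros l t -> (i <= l.+1)%N ->
  0 < (-1) ^+ (l.+1 - i) * (P l.+1).[t i].
Proof.
case: l => // l _ [t0 tl tI rt st].
case: i => [_|i].
  rewrite subn0 t0 normalized_ultrasphericalN// normalized_ultraspherical_at1//.
  by rewrite mulr1 -expr2 sqrr_sign.
rewrite ltnS leq_eqVlt => /orP[/eqP->|il].
  by rewrite tl subnn mul1r normalized_ultraspherical_at1.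
have /eqP Pi : root (P l.+1) (t i.+1) by apply: rt.
rewrite -(pmulr_rgt0 _ (addn_2lam_gt0 lam_ge0 l)) mulrCA.
rewrite normalized_ultraspherical_horner_rec// Pi mulr0 sub0r.
rewrite subSn// exprS mulN1r mulrNN mulrCA pmulr_rgt0//.
exact: (st i.+1).
Qed.

(** By [sign_next] each of the [l + 1] gaps contains a zero of [P l.+1], and the sign
    of [P l] there can be read off its factorization. *)
Lemma interlacing_zerosS l t : (0 < l)%N -> interlacing_zeros l t ->
  exists u, interlacing_zeros l.+1 u.
Proof.
move=> l0 It; have sN := sign_next l0 It.
have [a a0 PE] := normalized_ultraspherical_prod It.
case: It => [t0 tl tI _ _].
have /choice[z zP] : forall i, exists z, (i <= l)%N ->
    t i < z < t i.+1 /\ root (P l.+1) z.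
  move=> i; have [il|] := leqP i l; last by exists 0.
  have := @poly_ivt R ((-1) ^+ (l - i) *: P l.+1) (t i) (t i.+1).
  have si := sN i (leqW il); have sSi := sN i.+1 il.
  rewrite subSS in sSi; rewrite subSn// exprS mulN1r mulNr oppr_gt0 in si.
  rewrite !hornerZ (ltW si) (ltW sSi) ltW ?tI//; last by rewrite leqnn.
  move=> /(_ isT isT)[z /andP[tz zt]]; rewrite rootZ ?signr_eq0// => rz.
  exists z => _; split=> //; move/eqP: rz => rz.
  rewrite !lt_neqAle tz zt !andbT; apply/andP; split; apply/eqP => tE.
    by move: si; rewrite tE rz mulr0 ltxx.
  by move: sSi; rewrite -tE rz mulr0 ltxx.
exists (fun i => if i is j.+1 then if (j <= l)%N then z j else 1 else -1).
split=> //=; first by rewrite ltnn.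
- apply: increasing_uptoP => -[_|i] /=.
    by have [/andP[+ _] _] := zP 0%N (leq0n _); rewrite t0.
  rewrite !ltnS => il; rewrite il; have [/andP[_ zi] _] := zP i il.
  case: ltnP => li.
    by have [/andP[zi' _] _] := zP i.+1 li; exact: lt_trans zi'.
  by move: zi; rewrite (_ : i = l) ?tl//; apply/eqP; rewrite eqn_leq il.
- by move=> [|i]//; rewrite !ltnS => /andP[_ il]; rewrite il; case: (zP i il).
- move=> [|i]//; rewrite !ltnS => /andP[_ il]; rewrite il subSS.
  rewrite PE hornerZ mulrCA pmulr_rgt0//.
  by apply: sign_prod_XsubC => //; case: (zP i il).
Qed.

Lemma interlacing_zeros_exist l : (0 < l)%N -> exists t, interlacing_zeros l t.
Proof.
case: l => // l _; elim: l => [|l [t /interlacing_zerosS]]; last exact.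
exists (fun i => if i is j.+1 then if j is _.+1 then 1 else 0 else -1).
split=> //.
- by apply: increasing_uptoP => -[|[|]]//= _; rewrite ?ltrN10.
- by move=> [|[|]]//= _; rewrite normalized_ultraspherical1 rootX.
- by move=> [|[|]]//= _; rewrite normalized_ultraspherical0 hornerC mul1r.
Qed.

End Interlacing.
(** * The energy is strictly convex *)

Section Preliminaries.
Variable R : realType.

(** Strict concavity of [ln |.|] on either half-line; it is [1 + u < exp u] at
    [u = b / a - 1]. *)
Lemma ln_norm_tangent_lt (a b : R) : 0 < a * b -> b != a ->
  ln `|b| < ln `|a| + (b - a) / a.
Proof.
move=> ab0 ba; have a0 : a != 0 by apply: contraTneq ab0 => ->; rewrite mul0r ltxx.
have b0 : b != 0 by apply: contraTneq ab0 => ->; rewrite mulr0 ltxx.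
have r0 : 0 < b / a.
  have -> : b / a = a * b / a ^+ 2 by field.
  by rewrite divr_gt0// exprn_even_gt0.
rewrite -ltrBlDl -ln_div ?posrE ?normr_gt0// -normf_div gtr0_norm//.
rewrite -ltr_expR lnK ?posrE// mulrBl divff//.
have := @expR_gt1Dx R (b / a - 1); rewrite [1 + _]addrC subrK; apply.
by rewrite subr_eq0; apply: contraNneq ba => /(canRL (mulfVK a0)); rewrite mul1r => ->.
Qed.

Lemma ln_norm_tangent (a b : R) : 0 < a * b ->
  ln `|b| <= ln `|a| + (b - a) / a.
Proof.
move=> ab; have [->|/(ln_norm_tangent_lt ab)/ltW//] := eqVneq b a.
by rewrite subrr mul0r addr0.
Qed.

Lemma pair_sum_antisymmetric n (a d : 'I_n -> R) :
  \sum_(i < n) \sum_(j < n | j != i) (d i - d j) / (a i - a j) =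
  2 * \sum_(i < n) d i * \sum_(j < n | j != i) (a i - a j)^-1.
Proof.
transitivity (\sum_(i < n) \sum_(j < n | j != i) d i / (a i - a j) -
    \sum_(i < n) \sum_(j < n | j != i) d j / (a i - a j)).
  rewrite -sumrB; apply: eq_bigr => i _; rewrite -sumrB; apply: eq_bigr => j _.
  by rewrite mulrBl.
rewrite [X in _ - X](exchange_big_dep predT)//= -sumrB mulr_sumr.
apply: eq_bigr => i _; rewrite mulrA mulr_sumr.
rewrite [X in _ - X](eq_bigl (fun j : 'I_n => j != i)) => [|j]; last by rewrite eq_sym.
rewrite -sumrB; apply: eq_bigr => j _.
by rewrite -[a j - _]opprB invrN; ring.
Qed.

End Preliminaries.

Section Energy.
Variables (R : realType) (k l : nat).
Hypotheses (k_gt0 : (0 < k)%N) (l_gt0 : (0 < l)%N).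
Local Notation n := (k * l)%N.
Implicit Types (x y z : 'rV[R]_n) (q qt s : R).
Local Notation adm := (@admissible R n k l).

Lemma block_of (i : 'I_n) : exists j : 'I_k, (j * l <= i < j.+1 * l)%N.
Proof.
have jk : (i %/ l < k)%N by rewrite ltn_divLR.
by exists (Ordinal jk); rewrite leq_divM ltn_ceil.
Qed.

Lemma admissible_itv x i : adm x -> -1 < x 0 i < 1.
Proof.
move=> [_ _ xb]; have [j ji] := block_of i; have /andP[l1 l2] := xb _ _ ji.
have k0 : k%:R != 0 :> R by rewrite pnatr_eq0 -lt0n.
have jk := ltn_ord j; apply/andP; split.
- apply: le_lt_trans l1; have := @cos_pi_frac_le R k k (k - j).
  by rewrite mulrAC divff// mul1r cospi; apply; lia.
- apply: lt_le_trans l2 _; have := @cos_pi_frac_le R k (k - j - 1) 0.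
  by rewrite mul0r mul0r cos0; apply; lia.
Qed.

(** Two admissible configurations lie on the same side of every singularity of
    the energy; this makes the tangent inequality of [ln |.|] applicable. *)
Lemma admissible_node_side x y i (m : 'I_k.-1) : adm x -> adm y ->
  0 < (x 0 i - sieve_node R m) * (y 0 i - sieve_node R m).
Proof.
move=> [_ _ /(_ _ i)xb] [_ _ /(_ _ i)yb]; have [j ji] := block_of i.
have /andP[x1 x2] := xb _ ji; have /andP[y1 y2] := yb _ ji.
have jk := ltn_ord j; have mk := ltn_ord m.
have [jm|mj] := leqP (k - j) m.+1.
- have cm : sieve_node R m <= cos ((k - j)%:R * pi / k%:R).
    by apply: cos_pi_frac_le; lia.
  by rewrite mulr_gt0// subr_gt0 (le_lt_trans cm).
- have cm : cos ((k - j - 1)%:R * pi / k%:R) <= sieve_node R m.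
    by apply: cos_pi_frac_le; lia.
  by rewrite nmulr_rgt0 subr_lt0 (lt_le_trans _ cm).
Qed.

Lemma admissible_pair_side x y (i j : 'I_n) : adm x -> adm y -> j != i ->
  0 < (x 0 i - x 0 j) * (y 0 i - y 0 j).
Proof.
move=> [_ xI _] [_ yI _] ji; case: (ltngtP i j) => [ij|ij|/val_inj ij].
- by rewrite nmulr_rgt0 subr_lt0 ?xI ?yI.
- by rewrite mulr_gt0// subr_gt0 ?xI ?yI.
- by rewrite ij eqxx in ji.
Qed.

Lemma admissible_end_side x y i : adm x -> adm y ->
  0 < (x 0 i - 1) * (y 0 i - 1) /\ 0 < (x 0 i + 1) * (y 0 i + 1).
Proof.
move=> /(@admissible_itv _ i)/andP[x1 x2] /(@admissible_itv _ i)/andP[y1 y2].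
by split; [rewrite nmulr_rgt0 subr_lt0|apply: mulr_gt0; lra].
Qed.

Lemma admissible_convex x y s : 0 <= s <= 1 -> adm x -> adm y ->
  adm ((1 - s) *: x + s *: y).
Proof.
move=> /andP[s0 s1] [xB xI xb] [yB yI yb].
have s1' : 0 <= 1 - s by rewrite subr_ge0.
have conv_lt (a b a' b' : R) : a < b -> a' < b' ->
    (1 - s) * a + s * a' < (1 - s) * b + s * b'.
  move=> ab ab'; have [->|sN0] := eqVneq s 0; first by lra.
  apply: ler_ltD; first by rewrite ler_wpM2l// ltW.
  by rewrite ltr_pM2l// lt_def sN0.
have convE (a : R) : (1 - s) * a + s * a = a by ring.
split.
- move=> i; rewrite !mxE; have := xB i; have := yB i => /andP[y1 y2] /andP[x1 x2].
  rewrite -[X in X <= _](convE (-1)) -[X in _ && (_ <= X)](convE 1).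
  by rewrite !lerD// ler_wpM2l.
- by move=> i j ij; rewrite !mxE conv_lt ?xI ?yI.
- move=> j i ji; rewrite !mxE; have := xb _ _ ji; have := yb _ _ ji.
  move=> /andP[y1 y2] /andP[x1 x2].
  rewrite -[X in X < _]convE -[X in _ && (_ < X)]convE.
  by rewrite !conv_lt.
Qed.

(** [-2 force] is the gradient of the energy, see [energy_tangent_le]. *)
Definition force q qt x (i : 'I_n) : R :=
  \sum_(j < n | j != i) (x 0 i - x 0 j)^-1
  + q * ((x 0 i - 1)^-1 + (x 0 i + 1)^-1)
  + qt * \sum_(m < k.-1) (x 0 i - sieve_node R m)^-1.

(** The logarithm of the leading factor is a constant [C], which drops out of
    energy differences. *)
Lemma ln_monic_chebU : exists C : R, forall x i, adm x ->
  ln `|(monic_chebU k.-1).[x 0 i]| =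
  C + \sum_(m < k.-1) ln `|x 0 i - sieve_node R m|.
Proof.
have [c c0 UE] := chebU_prod R k_gt0.
have a0 : (2 ^+ k.-1)^-1 * c != 0 by rewrite mulf_neq0// invr_eq0 expf_neq0.
exists (ln `|(2 ^+ k.-1)^-1 * c|) => x i xA.
have f0 (m : 'I_k.-1) : 0 < `|x 0 i - sieve_node R m|.
  rewrite normr_gt0; have := admissible_node_side i m xA xA.
  by apply: contraTneq => ->; rewrite mul0r ltxx.
rewrite /monic_chebU UE scalerA hornerZ horner_prod normrM.
rewrite lnM ?posrE ?normr_gt0//; last first.
  by apply/prodf_neq0 => m _; rewrite hornerXsubC -normr_gt0.
congr (_ + _); rewrite normr_prod.
rewrite (eq_bigr (fun m => `|x 0 i - sieve_node R m|)) => [|m _]; last first.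
  by rewrite hornerXsubC.
suff [] : ln (\prod_(m < k.-1) `|x 0 i - sieve_node R m|) =
  \sum_(m < k.-1) ln `|x 0 i - sieve_node R m| /\
  0 < \prod_(m < k.-1) `|x 0 i - sieve_node R m| by [].
apply: (big_rec2 (fun p s : R => ln p = s /\ 0 < p)); first by rewrite ln1.
move=> m s p _ [<- p0]; split; last by rewrite mulr_gt0.
by rewrite lnM ?posrE.
Qed.

Section Tangent.
Variables (q qt : R) (x y : 'rV[R]_n).
Hypotheses (q_gt0 : 0 < q) (qt_ge0 : 0 <= qt) (x_adm : adm x) (y_adm : adm y).
Let d i := y 0 i - x 0 i.

Let pair_part : \sum_(i < n) \sum_(j < n | j != i) ln `|y 0 i - y 0 j| <=
  \sum_(i < n) \sum_(j < n | j != i) ln `|x 0 i - x 0 j| +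
  2 * \sum_(i < n) d i * \sum_(j < n | j != i) (x 0 i - x 0 j)^-1.
Proof.
rewrite -(pair_sum_antisymmetric (x 0)) -big_split/=; apply: ler_sum => i _.
rewrite -big_split/=; apply: ler_sum => j ji.
have -> : d i - d j = (y 0 i - y 0 j) - (x 0 i - x 0 j) by rewrite /d; ring.
exact/ln_norm_tangent/admissible_pair_side.
Qed.

Let node_part : \sum_(i < n) ln `|(monic_chebU k.-1).[y 0 i]| <=
  \sum_(i < n) ln `|(monic_chebU k.-1).[x 0 i]| +
  \sum_(i < n) d i * \sum_(m < k.-1) (x 0 i - sieve_node R m)^-1.
Proof.
have [C CE] := ln_monic_chebU.
rewrite -big_split/=; apply: ler_sum => i _; rewrite !CE// -addrA lerD2l.
rewrite mulr_sumr -big_split/=; apply: ler_sum => m _.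
have -> : d i = (y 0 i - sieve_node R m) - (x 0 i - sieve_node R m).
  by rewrite /d; ring.
exact/ln_norm_tangent/admissible_node_side.
Qed.

Let ln_oneBsqr z i : adm z ->
  ln (1 - z 0 i ^+ 2) = ln `|z 0 i - 1| + ln `|z 0 i + 1|.
Proof.
move=> /(@admissible_itv _ i)/andP[z1 z2].
rewrite ltr0_norm; last by lra.
rewrite gtr0_norm; last by lra.
by rewrite -lnM ?posrE; [congr ln; ring|lra|lra].
Qed.

Let end_term_lt i : y 0 i != x 0 i -> ln (1 - y 0 i ^+ 2) <
  ln (1 - x 0 i ^+ 2) + d i * ((x 0 i - 1)^-1 + (x 0 i + 1)^-1).
Proof.
move=> yx; rewrite !ln_oneBsqr//; have [s1 s2] := admissible_end_side i x_adm y_adm.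
rewrite mulrDr addrACA; apply: ltrD.
- have -> : d i = (y 0 i - 1) - (x 0 i - 1) by rewrite /d; ring.
  by apply: ln_norm_tangent_lt => //; apply: contra_neq yx => /addIr.
- have -> : d i = (y 0 i + 1) - (x 0 i + 1) by rewrite /d; ring.
  by apply: ln_norm_tangent_lt => //; apply: contra_neq yx => /addIr.
Qed.

Let end_term_le i : ln (1 - y 0 i ^+ 2) <=
  ln (1 - x 0 i ^+ 2) + d i * ((x 0 i - 1)^-1 + (x 0 i + 1)^-1).
Proof.
have [yx|/end_term_lt/ltW//] := eqVneq (y 0 i) (x 0 i).
by rewrite /d yx subrr mul0r addr0.
Qed.

Let force_sum : \sum_(i < n) d i * force q qt x i =
  \sum_(i < n) d i * \sum_(j < n | j != i) (x 0 i - x 0 j)^-1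
  + q * \sum_(i < n) d i * ((x 0 i - 1)^-1 + (x 0 i + 1)^-1)
  + qt * \sum_(i < n) d i * \sum_(m < k.-1) (x 0 i - sieve_node R m)^-1.
Proof.
rewrite !mulr_sumr -!big_split/=; apply: eq_bigr => i _.
by rewrite /force !mulrDr; ring.
Qed.

Lemma energy_tangent_le :
  energy k q qt x - 2 * \sum_(i < n) d i * force q qt x i <= energy k q qt y.
Proof.
have : \sum_(i < n) ln (1 - y 0 i ^+ 2) <= \sum_(i < n) ln (1 - x 0 i ^+ 2) +
    \sum_(i < n) d i * ((x 0 i - 1)^-1 + (x 0 i + 1)^-1).
  by rewrite -big_split/=; apply: ler_sum => i _.
rewrite -(ler_pM2l q_gt0) => end_part.
have := ler_wpM2l qt_ge0 node_part; move: end_part; have := pair_part.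
rewrite force_sum /energy !mulrDr; lra.
Qed.

(** The charges at the end points already make the energy strictly convex. *)
Lemma energy_tangent_lt : y != x ->
  energy k q qt x - 2 * \sum_(i < n) d i * force q qt x i < energy k q qt y.
Proof.
move=> yx; have [i yxi] : exists i, y 0 i != x 0 i.
  apply/existsP; apply: contraNT yx; rewrite negb_exists => /forallP xy.
  by apply/eqP/rowP => i; apply/eqP; have := xy i; rewrite negbK.
have : \sum_(i < n) ln (1 - y 0 i ^+ 2) < \sum_(i < n) ln (1 - x 0 i ^+ 2) +
    \sum_(i < n) d i * ((x 0 i - 1)^-1 + (x 0 i + 1)^-1).
  rewrite -big_split/= (bigD1 i)//= [X in _ < X](bigD1 i)//=.
  by apply: ltr_leD; [exact: end_term_lt|apply: ler_sum => j _; exact: end_term_le].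
rewrite -(ltr_pM2l q_gt0) => end_part.
have := ler_wpM2l qt_ge0 node_part; move: end_part; have := pair_part.
rewrite force_sum /energy !mulrDr; lra.
Qed.

End Tangent.

(** The two tangent inequalities at the intermediate point, weighted so that the
    first-order terms cancel. *)
Lemma energy_convex q qt x y s : 0 < q -> 0 <= qt -> adm x -> adm y ->
  0 <= s <= 1 ->
  energy k q qt ((1 - s) *: x + s *: y) <=
  (1 - s) * energy k q qt x + s * energy k q qt y.
Proof.
move=> q0 qt0 xA yA s01; have zA := admissible_convex s01 xA yA.
set z := (1 - s) *: x + s *: y in zA *.
have tx := energy_tangent_le q0 qt0 zA xA; have ty := energy_tangent_le q0 qt0 zA yA.
have [s0 s1] := andP s01; have s1' : 0 <= 1 - s by rewrite subr_ge0.
have E : (1 - s) * \sum_(i < n) (x 0 i - z 0 i) * force q qt z i +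
    s * \sum_(i < n) (y 0 i - z 0 i) * force q qt z i = 0.
  rewrite !mulr_sumr -big_split big1//= => i _.
  by rewrite !mxE; ring.
have := ler_wpM2l s1' tx; have := ler_wpM2l s0 ty; nra.
Qed.

(** A point without force minimizes the energy, and convexity leads downhill
    from any other configuration straight to it. *)
Lemma equilibrium_of_force0 q qt x : 0 < q -> 0 <= qt -> adm x ->
  (forall i, force q qt x i = 0) ->
  (forall y, adm y -> energy k q qt x <= energy k q qt y) /\
  (forall y, equilibrium k l q qt y <-> y = x).
Proof.
move=> q0 qt0 xA x0.
have dx0 y : \sum_(i < n) (y 0 i - x 0 i) * force q qt x i = 0.
  by rewrite big1// => i _; rewrite x0 mulr0.
have xmin y : adm y -> energy k q qt x <= energy k q qt y.
  by move=> yA; have := energy_tangent_le q0 qt0 xA yA; rewrite dx0 mulr0 subr0.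
split=> // y; split=> [[yA ymin]|->]; last first.
  by split=> //; rewrite near_withinE; apply: nearW => z /xmin.
apply/eqP/negPn/negP => yx.
have Exy : energy k q qt x < energy k q qt y.
  by have := energy_tangent_lt q0 qt0 xA yA yx; rewrite dx0 mulr0 subr0.
have path0 : (1 - s) *: y + s *: x @[s --> (0 : R)] --> (1 - 0) *: y + 0 *: x.
  apply: cvgD; (apply: cvgZ; last exact: cvg_cst) => //.
  by apply: cvgB => //; exact: cvg_cst.
have path : (1 - s) *: y + s *: x @[s --> (0 : R)^'+] --> y.
  by rewrite subr0 scale1r scale0r addr0 in path0; exact: cvg_at_right_filter.
have ynear : \forall s \near (0 : R)^'+, adm ((1 - s) *: y + s *: x) ->
    energy k q qt y <= energy k q qt ((1 - s) *: y + s *: x) by exact: path ymin.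
have [s /andP[s0 s1] sy] : exists2 s : R, 0 < s < 1 &
    adm ((1 - s) *: y + s *: x) ->
    energy k q qt y <= energy k q qt ((1 - s) *: y + s *: x).
  near (0 : R)^'+ => s; exists s; last by near: s.
  by apply/andP; split; near: s; [exact: nbhs_right_gt|exact: nbhs_right_lt].
have s01 : 0 <= s <= 1 by rewrite !ltW.
have := energy_convex q0 qt0 yA xA s01.
apply/negP; rewrite -ltNge (lt_le_trans _ (sy (admissible_convex s01 yA xA)))//.
rewrite -subr_gt0; have -> : forall a b : R, a - ((1 - s) * a + s * b) = s * (a - b).
  by move=> a b; ring.
by rewrite mulr_gt0 ?subr_gt0.
Unshelve. all: by end_near.
Qed.

End Energy.
(** * The zeros of the sieved polynomial *)

Section SievedZeros.
Variables (R : realType) (k l : nat) (lam : R) (t : nat -> R).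
Hypotheses (k_gt0 : (0 < k)%N) (l_gt0 : (0 < l)%N).
Hypothesis t_zeros : interlacing_zeros lam l t.
Local Notation n := (k * l)%N.
Local Notation P := (normalized_ultraspherical lam l).
Local Notation T := (@chebT R k).
Local Notation f := (P \Po T).

(** On every arc between consecutive sieve nodes [T_k] is a bijection onto
    ]-1, 1[, so each arc carries [l] zeros. With [j = i %/ l] the arc of [i], the
    angle solves [T_k (cos angle) = +- t], and the parity of [P] makes the sign
    harmless. *)
Definition sieved_angle (i : nat) : R :=
  ((k.-1 - i %/ l)%:R * pi + acos (t (i %% l).+1)) / k%:R.

Let kR_gt0 : 0 < k%:R :> R. Proof. by rewrite ltr0n. Qed.

Lemma sieved_angle_block (i j : nat) : (j < k)%N -> (j * l <= i < j.+1 * l)%N ->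
  (k - j - 1)%:R * pi / k%:R < sieved_angle i < (k - j)%:R * pi / k%:R.
Proof.
move=> jk /andP[ji ij].
have ijE : (i %/ l = j)%N.
  by apply/eqP; rewrite eqn_leq -ltnS ltn_divLR// ij leq_divRL.
have /andP[t1 t2] := interlacing_zeros_itv t_zeros (ltn_pmod i l_gt0).
rewrite /sieved_angle ijE !ltr_pM2r ?invr_gt0//.
have -> : (k.-1 - j)%N = (k - j - 1)%N by lia.
have -> : (k - j)%:R = (k - j - 1)%:R + 1 :> R by rewrite natr1; congr _%:R; lia.
by rewrite mulrDl mul1r ltrDl ltrD2l acos_gt0 ?acos_ltpi ?t1 ?t2 ?(ltW t1) ?(ltW t2).
Qed.

Let block_bounds i : (i < n)%N ->
  (i %/ l < k)%N /\ (i %/ l * l <= i < (i %/ l).+1 * l)%N.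
Proof. by move=> ik; rewrite ltn_divLR// leq_divM ltn_ceil. Qed.

Lemma sieved_angle_itv i : (i < n)%N -> sieved_angle i \in `[0, pi].
Proof.
move=> /block_bounds[jk ji]; have /andP[a1 a2] := sieved_angle_block jk ji.
rewrite in_itv/= (le_trans _ (ltW a1)) ?divr_ge0 ?mulr_ge0 ?pi_ge0 ?ler0n//=.
rewrite (le_trans (ltW a2))// ler_pdivrMr// mulrC ler_pM2l ?pi_gt0//.
by rewrite ler_nat leq_subr.
Qed.

Lemma sieved_angle_decr i i' : (i < i' < n)%N -> sieved_angle i' < sieved_angle i.
Proof.
move=> /andP[ii' i'n].
have [jk' /(sieved_angle_block jk')/andP[_ a2]] := block_bounds i'n.
have [jk /(sieved_angle_block jk)/andP[a1 _]] := block_bounds (ltn_trans ii' i'n).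
have [jj'|j'j] := ltnP (i %/ l) (i' %/ l).
  apply: (lt_trans a2); apply: le_lt_trans a1.
  rewrite ler_pM2r ?invr_gt0// ler_pM2r ?pi_gt0// ler_nat; lia.
have jE : (i %/ l = i' %/ l)%N by apply/eqP; rewrite eqn_leq j'j leq_div2r// ltnW.
have mm : (i %% l < i' %% l)%N.
  by have := divn_eq i l; have := divn_eq i' l; rewrite jE; lia.
rewrite /sieved_angle jE ltr_pM2r ?invr_gt0// ltrD2l.
have ml := ltn_pmod i l_gt0; have ml' := ltn_pmod i' l_gt0.
have [_ _ tI _ _] := t_zeros.
have /andP[b1 b2] := interlacing_zeros_itv t_zeros ml.
have /andP[c1 c2] := interlacing_zeros_itv t_zeros ml'.
rewrite -ltr_cos ?in_itv/= ?acos_ge0 ?acos_lepi ?acosK ?in_itv/=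
  ?(ltW b1) ?(ltW b2) ?(ltW c1) ?(ltW c2)//.
by apply: tI; lia.
Qed.

Definition sieved_zeros : 'rV[R]_n := \row_i cos (sieved_angle i).
Local Notation x := sieved_zeros.

Lemma admissible_sieved_zeros : admissible k l x.
Proof.
split.
- by move=> i; rewrite mxE cos_geN1 cos_le1.
- move=> i i' ii'; rewrite !mxE ltr_cos ?sieved_angle_itv//.
  by rewrite sieved_angle_decr// ii' ltn_ord.
- move=> j i ji; rewrite mxE.
  have /andP[a1 a2] := sieved_angle_block (ltn_ord j) ji.
  rewrite !ltr_cos ?pi_frac_itv ?sieved_angle_itv ?a1 ?a2//; lia.
Qed.

Lemma chebT_sieved_zeros (i : 'I_n) :
  T.[x 0 i] = (-1) ^+ (k.-1 - i %/ l) * t (i %% l).+1.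
Proof.
have /andP[t1 t2] := interlacing_zeros_itv t_zeros (ltn_pmod i l_gt0).
rewrite mxE chebT_cos /sieved_angle mulrCA divff ?mulr1; last by rewrite gt_eqF.
rewrite addrC mulr_natl (alternatingn (@cosDpi R)) acosK//.
by rewrite in_itv/= (ltW t1) (ltW t2).
Qed.

Hypothesis lam_ge0 : 0 <= lam.

Lemma root_ultraspherical_chebT_sieved_zeros i : root P T.[x 0 i].
Proof.
have [_ _ _ rt _] := t_zeros.
have /eqP Pt : root P (t (i %% l).+1) by apply: rt; rewrite /= ltn_pmod.
rewrite chebT_sieved_zeros -signr_odd; case: odd.
- by rewrite expr1 mulN1r /root normalized_ultrasphericalN// Pt mulr0.
- by rewrite expr0 mul1r /root Pt.
Qed.

Lemma sieved_zeros_inj : injective (fun i => x 0 i).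
Proof.
have [_ xI _] := admissible_sieved_zeros.
move=> i j /= xij; case: (ltngtP i j) => [/xI|/xI|/val_inj//];
  by rewrite xij ltxx.
Qed.

Lemma comp_sieved_zeros_prod : exists2 a : R, a != 0 &
  f = a *: \prod_(i < n) ('X - (x 0 i)%:P).
Proof.
exists (lead_coef f).
  have f1 : f.[1] = 1 by rewrite horner_comp chebT1 normalized_ultraspherical_at1.
  rewrite lead_coef_eq0; apply/eqP => f0; move: f1; rewrite f0 horner0.
  by move/esym/eqP; rewrite oner_eq0.
apply: poly_eq_prod_roots.
- rewrite (leq_trans (size_comp_poly_leq _ _))// ltnS mulnC leq_mul//.
  + by have := size_chebT R k; case: (size T) => // m; rewrite ltnS.
  + by have := size_normalized_ultraspherical lam l; case: (size P) => // m; rewrite ltnS.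
- exact: sieved_zeros_inj.
- by move=> i; rewrite /root horner_comp; exact: root_ultraspherical_chebT_sieved_zeros.
Qed.

Lemma root_comp_sieved_zeros z : root f z <-> exists i, z = x 0 i.
Proof.
have [a a0 fE] := comp_sieved_zeros_prod.
split=> [|[i ->]]; last first.
  by rewrite /root horner_comp; exact: root_ultraspherical_chebT_sieved_zeros.
rewrite fE rootZ// /root horner_prod prodf_seq_eq0 => /hasP[i _].
by rewrite /= hornerXsubC subr_eq0 => /eqP ->; exists i.
Qed.

(** The differential equation of [P] at [T_k(x_i)], transported through [T_k] by
    [(1 - x^2) T_k'^2 = k^2 (1 - T_k^2)], gives [f''/f'] at [x_i]; the term with
    [T_k] is absorbed by the charges at the zeros of [U_{k-1}]. *)
Lemma force_sieved_zeros (q : R) i : lam = 2 * q - 2^-1 -> force q lam x i = 0.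
Proof.
move=> lamE; have xA := admissible_sieved_zeros.
have /andP[xi1 xi2] := admissible_itv k_gt0 l_gt0 i xA.
have Pr := root_ultraspherical_chebT_sieved_zeros i.
have [a a0 fE] := comp_sieved_zeros_prod.
have := horner_deriv2_prod_XsubC i a0 sieved_zeros_inj.
rewrite -fE => -[f'0].
rewrite /force; set S := \sum_(j < _ | _) _ => f''E.
have [c c0 UE] := chebU_prod R k_gt0.
have nodeN (m : 'I_k.-1) : x 0 i != sieve_node R m.
  have := admissible_node_side k_gt0 l_gt0 i m xA xA.
  by apply: contraTneq => ->; rewrite subrr mul0r ltxx.
have WE : chebUpred k = chebU k.-1 :> {poly R} by case: k k_gt0.
have := @horner_deriv_prod_XsubC R _ (index_enum 'I_k.-1) xpredT
  (@sieve_node R k) (x 0 i) (fun m _ => nodeN m).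
move/(congr1 (fun z => c * z)); rewrite -hornerZ -derivZ mulrA -hornerZ -UE -WE.
set Q := \sum_(m < _) _ => W'E.
have := congr1 (horner^~ (x 0 i)) (chebT_pell R k).
have := congr1 (horner^~ (x 0 i)) (deriv_chebUpred R k).
have x21 : 1 - x 0 i ^+ 2 != 0.
  by rewrite subr_eq0 eq_sym -subr_eq0 subr_sqr_1 mulf_neq0//; apply/eqP; lra.
have ode := ultraspherical_ode_root lam_ge0 _ Pr.
move: f'0 f''E; rewrite !(deriv_comp, derivM) deriv_chebT derivM -polyC_natr.
rewrite derivC mul0r add0r.
rewrite !(hornerD, hornerN, hornerM, hornerC, hornerX, hornerXn, horner_comp, W'E).
move: ode; set tau := T.[x 0 i]; set w := (chebUpred k).[x 0 i].
set p' := P^`().[tau]; set p'' := (P^`())^`().[tau].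
rewrite !mulf_eq0 !negb_or => ode /and3P[p'0 k0 w0] f''E W'' pell.
have xi0 : x 0 i - 1 != 0 /\ x 0 i + 1 != 0 by split; apply/eqP; lra.
move: (x 0 i) x21 W'' pell xi0 => y y21 W'' pell [y1 y2].
have tauE : 1 - tau ^+ 2 = (1 - y ^+ 2) * w ^+ 2.
  by rewrite -[X in X - tau ^+ 2]pell; ring.
rewrite tauE in ode; have {}ode := ode (mulf_neq0 y21 (expf_neq0 2 w0)).
have forceS : (1 - y ^+ 2) * w * (2 * S) = 2 * lam * k%:R * tau + y * w.
  apply: (mulfI (mulf_neq0 p'0 k0)).
  transitivity ((1 - y ^+ 2) * (2 * (p' * (k%:R * w)) * S)); first by ring.
  rewrite -f''E.
  transitivity (k%:R ^+ 2 * ((1 - y ^+ 2) * w ^+ 2 * p'') +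
    p' * k%:R * ((1 - y * y) * (w * Q))); first by ring.
  by rewrite ode W''; ring.
have forceSQ : (1 - y ^+ 2) * (2 * S + 2 * lam * Q) = 4 * q * y.
  apply: (mulfI w0).
  transitivity ((1 - y ^+ 2) * w * (2 * S) + 2 * lam * ((1 - y * y) * (w * Q))).
    by ring.
  by rewrite forceS W'' lamE; field.
apply: (mulfI y21); rewrite mulr0.
transitivity (((1 - y ^+ 2) * (2 * S + 2 * lam * Q) - 4 * q * y) / 2).
  by field; rewrite y1 y2.
by rewrite forceSQ subrr mul0r.
Qed.

End SievedZeros.

Theorem theorem6p1 (R : realType) (k l n : nat) (q qt lam : R)
    (hk : (3 <= k)%N) (hl : (0 < l)%N) (hn : n = (k * l)%N)
    (hq : 4^-1 <= q) (hqt : qt = 2 * q - 2^-1) (hlam : lam = 2 * q - 2^-1) :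
  sieved_ultraspherical k lam n
    = normalized_ultraspherical lam l \Po chebT k
  /\ exists x : 'rV[R]_n,
    [/\ admissible k l x,
        forall t : R, root (sieved_ultraspherical k lam n) t <->
                      exists i : 'I_n, t = x 0 i,
        forall y : 'rV[R]_n, admissible k l y ->
          energy k q qt x <= energy k q qt y
      & forall y : 'rV[R]_n, equilibrium k l q qt y <-> y = x].
Proof.
subst n; have lam0 : 0 <= lam by lra.
have k0 : (0 < k)%N by lia.
have cE : sieved_ultraspherical k lam (k * l) =
    normalized_ultraspherical lam l \Po chebT k.
  by rewrite mulnC sieved_ultraspherical_comp//; lia.
split=> //; have [t t_zeros] := interlacing_zeros_exist lam0 hl.
exists (sieved_zeros k l t); have xA := admissible_sieved_zeros k0 hl t_zeros.
have q0 : 0 < q by lra.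
have qt0 : 0 <= qt by rewrite hqt -hlam.
have x0 i : force q qt (sieved_zeros k l t) i = 0.
  by rewrite hqt -hlam (force_sieved_zeros k0 hl t_zeros lam0).
have [xmin xeq] := equilibrium_of_force0 k0 hl q0 qt0 xA x0.
by split=> // z; rewrite cE; exact: root_comp_sieved_zeros.
Qed.
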